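(* Let $\boldsymbol{\lambda}=(\lambda_1\ge\lambda_2\ge\dots)$ be a partition of a positive integer with finitely many (positive) parts, the sums below being over the indices of the parts. (1) For an arbitrary partition $\boldsymbol\lambda$, $$\sum_i\binom{\lambda_i+1}{3}=\frac{1}{2\sum_i\lambda_i}\sum_{i,j}\ \sum_{k=0}^{\min\{\lambda_i-1,\lambda_j-1\}}\binom{\lambda_i+\lambda_j-2k}{3},$$ where the sum $\sum_{i,j}$ is over all ordered pairs $(i,j)$ (including $i=j$). (2) If $\boldsymbol\lambda$ is the partition formed by the sizes of the Jordan blocks of a nonzero nilpotent element of $\mathfrak{sp}(\mathbb V)$ acting on $\mathbb V$ (with $\dim\mathbb V$ even), then $$\sum_i\binom{\lambda_i+1}{3}=\frac{1}{(\sum_i\lambda_i)+2}\left(\sum_{i<j}\sum_{k=0}^{\lambda_j-1}\binom{\lambda_i+\lambda_j-2k}{3}+\sum_i\sum_{k=0}^{[(\lambda_i-1)/2]}\binom{2\lambda_i-4k}{3}\right).$$ (3) If $\boldsymbol\lambda$ is the partition formed by the sizes of the Jordan blocks of a nonzero nilpotent element of $\mathfrak{so}(\mathbb V)$ acting on $\mathbb V$ (with $\dim\mathbb V\ge5$), then $$\sum_i\binom{\lambda_i+1}{3}=\frac{1}{(\sum_i\lambda_i)-2}\left(\sum_{i<j}\sum_{k=0}^{\lambda_j-1}\binom{\lambda_i+\lambda_j-2k}{3}+\sum_i\sum_{k=1}^{[\lambda_i/2]}\binom{2\lambda_i+2-4k}{3}\right).$$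
   Context: Here $[x]$ denotes the integer part of $x$, and $\binom{m}{3}=m(m-1)(m-2)/6$ for integers $m\ge0$ (so it is $0$ for $m\in\{0,1,2\}$). $\mathbb V$ is a finite-dimensional vector space over an algebraically closed field of characteristic zero, equipped with a non-degenerate skew-symmetric (resp. symmetric) bilinear form in the case of $\mathfrak{sp}(\mathbb V)$ (resp. $\mathfrak{so}(\mathbb V)$). *)

(* Defs.v *)
From HB Require Import structures.
From mathcomp Require Import all_boot all_order all_algebra.

Set Implicit Arguments.
Unset Strict Implicit.
Unset Printing Implicit Defensive.

Import GRing.Theory.
Local Open Scope ring_scope.

(* A partition is given by the family of its r (positive) parts. *)
Definition is_partition (r : nat) (lambda : 'I_r -> nat) : Prop :=
  (forall i, 0 < lambda i)%N /\
  (forall i j : 'I_r, i <= j -> lambda j <= lambda i)%N.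

Definition is_nilpotent (K : fieldType) (V : vectType K) (X : 'End(V)) : Prop :=
  exists m : nat, forall v : V, iter m X v = 0.

(* X belongs to the Lie algebra of the isometry group of the form B. This is
   sp(V) when B is non-degenerate and skew-symmetric, and so(V) when B is
   non-degenerate and symmetric. *)
Definition in_isometry_lie (K : fieldType) (V : vectType K)
    (B : V -> V -> K) (X : 'End(V)) : Prop :=
  forall u v : V, B (X u) v + B u (X v) = 0.

(* The nilpotent Jordan block of size m: ones on the superdiagonal. *)
Definition jordan_block (K : fieldType) (m : nat) : 'M[K]_m :=
  \matrix_(i < m, j < m) (j == i.+1 :> nat)%:R.

(* The parts of lambda are the sizes of the Jordan blocks of the nilpotent
   endomorphism X: in some basis of V, the matrix of X is block diagonal with
   nilpotent Jordan blocks of these sizes. The cast identifies the dimension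
   of V with the sum of the parts. *)
Definition jordan_type (K : fieldType) (V : vectType K) (X : 'End(V))
    (r : nat) (lambda : 'I_r -> nat) : Prop :=
  exists (dimV : (\sum_(i < r) lambda i)%N = \dim {:V})
         (e : (\dim {:V}).-tuple V),
    basis_of {:V} e /\
    passmx.mxof e e X =
      castmx (dimV, dimV) (\mxdiag_(i < r) jordan_block K (lambda i)).

(* Main.v *)
Require Import Defs.
From HB Require Import structures.
From mathcomp Require Import all_boot all_order all_algebra.
From mathcomp Require Import zify ring.

(* Write c_n = 'C(n+1, 3); 2 c_n is the trace of h^2 on the irreducible
   sl_2-module V_n of dimension n. Comparing these traces on both sides of the
   Clebsch-Gordan decompositions of V_a (x) V_b, Sym^2 V_a and Lambda^2 V_a gives
   the values b c_a + a c_b, (a + 2) c_a and (a - 2) c_a of the inner sums; these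
   are proved by induction, peeling off the first term. Summed over the pairs of
   parts, they give a multiple of sum_i c_(lambda_i). *)

Set Implicit Arguments.
Unset Strict Implicit.
Unset Printing Implicit Defensive.

Import GRing.Theory Num.Theory.
Local Open Scope ring_scope.

(** Over [rat] each binomial becomes a polynomial free of truncated subtraction, so the inductive
    steps below reduce to [field]. *)
Lemma natr_bin3 (n : nat) :
  'C(n.+1, 3)%:R = (n%:R + 1) * n%:R * (n%:R - 1) / 6 :> rat.
Proof.
have bin2R m : 'C(m, 2)%:R = m%:R * (m%:R - 1) / 2 :> rat.
  elim: m => [|m IHm]; first by rewrite bin0n /=; field.
  by rewrite binS bin1 natrD IHm -natr1; field.
elim: n => [|n IHn]; first by rewrite bin_small //=; field.
by rewrite binS natrD IHn bin2R -!natr1; field.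
Qed.

(** The [k]-th summand is c_n for the constituent V_n of V_a (x) V_b with n = a + b - 1 - 2k. *)
Lemma sum_bin3_tensor (a b : nat) : (b <= a)%N ->
  (\sum_(0 <= k < b) 'C(a + b - 2 * k, 3) = b * 'C(a.+1, 3) + a * 'C(b.+1, 3))%N.
Proof.
(* With a = d + b and d fixed, dropping the term k = 0 lowers both a and b by one, so induction on b
   applies. *)
move=> /subnK <-; move: (a - b)%N => d.
elim: b => [|b IHb]; first by rewrite big_geq // (@bin_small 1) // muln0.
rewrite big_nat_recl //.
have shiftE k : (d + b.+1 + b.+1 - 2 * k.+1 = d + b + b - 2 * k)%N by lia.
under eq_bigr => k _ do rewrite shiftE.
rewrite IHb muln0 subn0.
rewrite (_ : (d + b.+1 + b.+1 = (d + b + b).+2)%N); last by lia.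
apply/eqP; rewrite -(eqr_nat rat) addnS; apply/eqP.
by rewrite !(natr_bin3, natrD, natrM) -!natr1 ?(natrD, natrM); field.
Qed.

Lemma nat_ind2 (P : nat -> Prop) :
  P 0%N -> P 1%N -> (forall n, P n -> P n.+2) -> forall n, P n.
Proof.
move=> P0 P1 PSS n; suff [] : P n /\ P n.+1 by [].
by elim: n => [|n [Pn PSn]]; split=> //; apply: PSS.
Qed.

(** Sym^2 V_a has constituents of dimension 2a - 1 - 4k. Dropping the largest leaves those of Sym^2
    V_(a-2), hence the two-step induction. *)
Lemma sum_bin3_sym2 (a : nat) :
  (\sum_(0 <= k < uphalf a) 'C(2 * a - 4 * k, 3) = (a + 2) * 'C(a.+1, 3))%N.
Proof.
elim/nat_ind2: a => [||a IHa]; first by rewrite big_geq.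
  by rewrite big_nat1.
rewrite /= big_nat_recl //.
have shiftE k : (2 * a.+2 - 4 * k.+1 = 2 * a - 4 * k)%N by lia.
under eq_bigr => k _ do rewrite shiftE.
rewrite IHa muln0 subn0 (_ : (2 * a.+2 = (2 * a + 3).+1)%N); last by lia.
apply/eqP; rewrite -(eqr_nat rat); apply/eqP.
by rewrite !(natr_bin3, natrD, natrM) -!natr1 ?(natrD, natrM); field.
Qed.

Lemma sum_bin3_alt2 (a : nat) :
  (\sum_(1 <= k < a./2.+1) 'C(2 * a + 2 - 4 * k, 3) + 2 * 'C(a.+1, 3)
   = a * 'C(a.+1, 3))%N.
Proof.
rewrite big_add1 /=.
elim/nat_ind2: a => [||a IHa]; first by rewrite big_geq.
  by rewrite big_geq.
rewrite /= big_nat_recl //.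
have shiftE k : (2 * a.+2 + 2 - 4 * k.+2 = 2 * a + 2 - 4 * k.+1)%N by lia.
under eq_bigr => k _ do rewrite shiftE.
rewrite (_ : (2 * a.+2 + 2 - 4 * 1 = (2 * a + 1).+1)%N); last by lia.
move: IHa; move: (\sum_(0 <= k < _) _)%N => S IHa.
(* In [rat] the factor a - 2 can be isolated without truncation. *)
have {}IHa : S%:R = (a%:R - 2) * 'C(a.+1, 3)%:R :> rat.
  by rewrite mulrBl -!natrM -IHa natrD addrK.
apply/eqP; rewrite -(eqr_nat rat); apply/eqP.
by rewrite !(IHa, natr_bin3, natrD, natrM) -!natr1 ?(natrD, natrM); field.
Qed.

Section PairSums.

Variables (r : nat) (l c : 'I_r -> nat).

Lemma sum_pairs :
  (\sum_(i < r) \sum_(j < r) (l j * c i + l i * c j)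
   = 2 * (\sum_i l i) * \sum_i c i)%N.
Proof.
under [LHS]eq_bigr => i _ do
  rewrite big_split -big_distrl -big_distrr /=.
by rewrite big_split -big_distrl -big_distrr /= -mulnA mul2n addnn.
Qed.

(** Exchanging the indices in the terms [l i * c j] makes the coefficient of [c i] the sum of [l j]
    over j > i, j < i and j = i, which is the full sum of [l]. *)
Lemma sum_ltn_pairs :
  (\sum_(i < r) \sum_(j < r | i < j) (l j * c i + l i * c j)
     + \sum_i l i * c i = (\sum_i l i) * \sum_i c i)%N.
Proof.
under [X in (X + _ = _)%N]eq_bigr => i _ do rewrite big_split.
rewrite big_split /= [X in (_ + X + _)%N](exchange_big_dep predT) //=.
rewrite -!big_split big_distrr /=; apply: eq_bigr => i _.
rewrite big_distrl /= [RHS](bigID (fun j : 'I_r => i < j)%N) /= -addnA; congr (_ + _)%N.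
rewrite [RHS](bigD1 i) ?ltnn //= addnC; congr (_ + _)%N.
by apply: eq_bigl => j; rewrite -leqNgt ltn_neqAle andbC.
Qed.

End PairSums.

Theorem mainTheorem6 (r : nat) (lambda : 'I_r -> nat)
    (part_lambda : is_partition lambda)
    (lambda_pos : (0 < \sum_(i < r) lambda i)%N) :
  [/\ (\sum_(i < r) 'C((lambda i).+1, 3))%N%:R
        = 1 / (2 * \sum_(i < r) lambda i)%N%:R
          * (\sum_(i < r) \sum_(j < r)
               \sum_(0 <= k < (minn (lambda i - 1) (lambda j - 1)).+1)
                 'C(lambda i + lambda j - 2 * k, 3))%N%:R :> rat,
      (forall (K : closedFieldType) (charK : [pchar K] =i pred0)
              (V : vectType K) (B : {skew_symmetric V}) (X : 'End(V)),
         nondegenerate B ->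
         ~~ odd (\dim {:V}) ->
         in_isometry_lie B X ->
         X != 0 -> is_nilpotent X ->
         jordan_type X lambda ->
         (\sum_(i < r) 'C((lambda i).+1, 3))%N%:R
           = 1 / ((\sum_(i < r) lambda i)%N%:R + 2)
             * ((\sum_(i < r) \sum_(j < r | (i < j)%N)
                   \sum_(0 <= k < (lambda j - 1).+1)
                     'C(lambda i + lambda j - 2 * k, 3))%N%:R
                + (\sum_(i < r) \sum_(0 <= k < ((lambda i - 1) %/ 2).+1)
                     'C(2 * lambda i - 4 * k, 3))%N%:R) :> rat)
    & (forall (K : closedFieldType) (charK : [pchar K] =i pred0)
              (V : vectType K) (B : {symmetric V}) (X : 'End(V)),
         nondegenerate B ->
         (5 <= \dim {:V})%N ->
         in_isometry_lie B X ->
         X != 0 -> is_nilpotent X ->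
         jordan_type X lambda ->
         (\sum_(i < r) 'C((lambda i).+1, 3))%N%:R
           = 1 / ((\sum_(i < r) lambda i)%N%:R - 2)
             * ((\sum_(i < r) \sum_(j < r | (i < j)%N)
                   \sum_(0 <= k < (lambda j - 1).+1)
                     'C(lambda i + lambda j - 2 * k, 3))%N%:R
                + (\sum_(i < r) \sum_(1 <= k < (lambda i %/ 2).+1)
                     'C(2 * lambda i + 2 - 4 * k, 3))%N%:R) :> rat)].
Proof.
have [l_gt0 l_anti] := part_lambda.
(* Parts are positive, so the inclusive bound [lambda i - 1] is the half-open bound [lambda i]. *)
have predK i : (lambda i - 1).+1 = lambda i by rewrite subn1 prednK.
pose c i := 'C((lambda i).+1, 3).
set N := (\sum_(i < r) lambda i)%N in lambda_pos *.
set C := (\sum_(i < r) 'C((lambda i).+1, 3))%N.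
set T := (\sum_(i < r) \sum_(j < r | (i < j)%N) _)%N.
(* For i < j the parts are ordered as [sum_bin3_tensor] requires. The missing diagonal is supplied
   by Sym^2 in (2) and Lambda^2 in (3), with an excess or a deficit of 2C. *)
have TE : (T + \sum_i lambda i * c i = N * C)%N.
  rewrite -sum_ltn_pairs; congr (_ + _)%N; apply: eq_bigr => i _.
  by apply: eq_bigr => j lt_ij; rewrite predK sum_bin3_tensor // l_anti // ltnW.
split.
- set S := (\sum_(i < r) _)%N.
  have -> : S = (2 * N * C)%N.
    rewrite -sum_pairs; apply: eq_bigr => i _; apply: eq_bigr => j _.
    rewrite -minnSS !predK; case: (leqP (lambda i) (lambda j)) => [le_ij | /ltnW le_ji].
      by under eq_bigr => k _ do rewrite addnC; rewrite sum_bin3_tensor // addnC.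
    by rewrite sum_bin3_tensor.
  by rewrite (natrM _ (2 * N)) mul1r mulKf // pnatr_eq0 -lt0n muln_gt0.
- move=> *; set S := (\sum_(i < r) _)%N.
  have SE : S = (\sum_i lambda i * c i + 2 * C)%N.
    rewrite big_distrr -big_split; apply: eq_bigr => i _ /=.
    rewrite -mulnDl -sum_bin3_sym2; congr (\sum_(0 <= k < _) _)%N.
    (* The bounds [((lambda i - 1) %/ 2).+1] and [uphalf (lambda i)] agree only for a positive
       part. *)
    by have := l_gt0 i; lia.
  rewrite -!natrD (_ : (T + S = (N + 2) * C)%N); last by rewrite SE addnA TE -mulnDl.
  by rewrite natrM mul1r mulKf // pnatr_eq0 addn2.
move=> K _ V B X _ dimV _ _ _ [dimE _]; set S := (\sum_(i < r) _)%N.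
have SE : (S + 2 * C = \sum_i lambda i * c i)%N.
  rewrite big_distrr -big_split; apply: eq_bigr => i _ /=.
  by rewrite divn2 sum_bin3_alt2.
(* The Jordan type gives N = dim V >= 5, so N - 2 is not truncated and the denominator is
   nonzero. *)
have N_ge2 : (2 <= N)%N by rewrite /N dimE (leq_trans _ dimV).
have N2_neq0 : (N - 2)%N%:R != 0 :> rat.
  by rewrite pnatr_eq0 subn_eq0 -ltnNge /N dimE (leq_trans _ dimV).
rewrite -natrD -natrB // (_ : (T + S = (N - 2) * C)%N).
  by rewrite natrM mul1r mulKf.
by rewrite mulnBl -TE -SE addnA addnK.
Qed.
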